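(* Let $\Gamma$ be a finitely generated profinite group with positive rank gradient, and let $A,B$ be finitely generated closed subgroups of infinite index in $\Gamma$. Then there exists an open subgroup $B_0$ of $B$ such that the closed subgroup of $\Gamma$ generated by $A$ and $B_0$ has infinite index in $\Gamma$.
   Context: For profinite groups, only closed subgroups are considered, and generation is topological: $d(U)$ is the minimal cardinality of a subset generating a dense subgroup of $U$, and ''finitely generated'' means $d<\infty$. The rank gradient of a finitely generated profinite group $\Gamma$ is $\nabla\Gamma=\inf_U\frac{d(U)-1}{[\Gamma:U]}$, where $U$ ranges over the open (equivalently, closed finite index) subgroups of $\Gamma$. *)

(* Defs.v *)
From HB Require Import structures.
From mathcomp Require Import all_boot all_order all_algebra.
From mathcomp Require Import all_classical all_reals all_analysis.
Set Implicit Arguments. Unset Strict Implicit. Unset Printing Implicit Defensive.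
Import Order.TTheory GRing.Theory Num.Theory.
Local Open Scope classical_set_scope.

Record profinite_group := ProfiniteGroup {
  pg_sort :> topologicalType;
  pg_mul : pg_sort -> pg_sort -> pg_sort;
  pg_inv : pg_sort -> pg_sort;
  pg_one : pg_sort;
  pg_mulA : forall x y z, pg_mul x (pg_mul y z) = pg_mul (pg_mul x y) z;
  pg_mul1 : forall x, pg_mul pg_one x = x;
  pg_mulV : forall x, pg_mul (pg_inv x) x = pg_one;
  pg_mul_cont : continuous (fun p : pg_sort * pg_sort => pg_mul p.1 p.2);
  pg_inv_cont : continuous pg_inv;
  pg_compact : compact [set: pg_sort];
  pg_hausdorff : hausdorff_space pg_sort;
  pg_tdisc : totally_disconnected [set: pg_sort]
}.

Section ProfiniteDefs.
Variable G : profinite_group.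
Implicit Types (H U A B S : set G).

Definition is_subgroup H :=
  H (pg_one G) /\ (forall x y, H x -> H y -> H (pg_mul x y)) /\
  (forall x, H x -> H (pg_inv x)).

Definition closed_subgroup H := is_subgroup H /\ closed H.

Definition open_subgroup U := is_subgroup U /\ open U.

Definition open_subgroup_of B U :=
  is_subgroup U /\ U `<=` B /\ exists O : set G, open O /\ U = B `&` O.

Definition gen_closed S : set G :=
  \bigcap_(H in [set H | closed_subgroup H /\ S `<=` H]) H.

Definition lcosets H : set (set G) :=
  [set [set pg_mul g h | h in H] | g in [set: G]].

Definition index_is H (k : nat) := (lcosets H #= `I_k)%card.

Definition finite_index H := finite_set (lcosets H).

Definition generated_by H (s : seq G) := {subset s <= H} /\ gen_closed [set x | x \in s] = H.

Definition fin_generated H := exists s : seq G, generated_by H s.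

Definition rank_is H (n : nat) :=
  (exists s : seq G, size s = n /\ generated_by H s) /\
  (forall s : seq G, generated_by H s -> (n <= size s)%N).

(* The rank gradient inf_U (d(U)-1)/[G:U] is positive, i.e. the infimum is
   bounded below by some eps > 0. *)
Definition positive_rank_gradient :=
  exists eps : rat, (0 < eps)%R /\
    forall U n k, open_subgroup U -> rank_is U n -> index_is U k ->
      (eps <= (n%:R - 1) / k%:R)%R.

End ProfiniteDefs.

(* Main.v *)
Require Import Defs.
From HB Require Import structures.
From mathcomp Require Import all_boot all_order all_algebra.
From mathcomp Require Import all_classical all_reals all_analysis.
From mathcomp Require Import zify.
Set Implicit Arguments. Unset Strict Implicit. Unset Printing Implicit Defensive.
Import Order.TTheory GRing.Theory Num.Theory.
Local Open Scope classical_set_scope.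

(** Suppose [G:U] <= E d(U) for all open U. Choose open U containing A and V
    containing B of large index, and let a, b be the sizes of the A-orbit of V
    in G/V and of the B-orbit of U in G/U. The closed subgroup W generated by
    A n V and B n U has at most a d(A) + b d(B) generators by Schreier's bound,
    while its index is at least [G : U n V], hence at least a [G:U] and
    b [G:V]; so W has infinite index. Now take an open T containing W with
    [G:T] much larger than a b, an open normal N inside T n U, and H = AN. As
    B A N is covered by a b translates of T, the B-orbit of H in G/H has size
    at most (a b / [G:T]) [G:H], a small proportion of [G:H]. Hence A and
    B n H generate a subgroup of H with too few generators to be of finite
    index. *)

(** * Clopen neighbourhoods in compact Hausdorff totally disconnected spaces *)

Lemma clopen_sub_open (T : topologicalType) (x : T) (O : set T) :
  compact [set: T] -> open O ->
  (forall y, ~ O y -> exists C, [/\ clopen C, C x & ~ C y]) ->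
  exists C, [/\ clopen C, C x & C `<=` O].
Proof.
move=> cT oO sep.
pose I := [set C : set T | clopen C /\ C x].
(* Along [F] the set [D] shrinks below every clopen neighbourhood of [x]. The near-covering form of
   compactness of the complement of [O] then replaces a finite subcover and the intersection of the
   chosen clopen sets. *)
pose F := filter_from I (fun C => [set D | D `<=` C]).
have FF : Filter F.
  apply: filter_from_filter; first by exists setT; split=> //; exact: clopenT.
  move=> C D [cC Cx] [cD Dx]; exists (C `&` D); first by split=> //; exact: clopenI.
  by move=> E /= ECD; split=> z /ECD[].
have /compact_near_coveringP/(_ _ F (fun D y => ~ D y) FF)[|C [cC Cx] CO] :
    compact (~` O).
  by apply: (subclosed_compact _ cT) => //; exact: open_closedC.
- move=> y /sep[C [[oC cC] Cx nCy]].
  exists (~` C, [set D | D `<=` C]); first split => /=.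
  + by apply: open_nbhs_nbhs; split=> //; exact: closed_openC.
  + by exists C.
  + by move=> [z D] /= [nCz DC] /DC.
- exists C; split=> // z Cz; apply: contrapT => nOz.
  by apply: (CO C _ z nOz).
Qed.

(** If the quasi-component [Q] splits into disjoint closed parts [D] and [E] with [x] in [D],
    normality gives a neighbourhood [V] of [D] whose closure misses [E]. Some clopen [C] around [x]
    avoids the boundary of [V], so the part of [C] in the interior of [V] is clopen, hence contains
    [Q], and [E] is empty. *)
Lemma quasi_component_connected (T : topologicalType) (x : T) :
  compact [set: T] -> hausdorff_space T ->
  connected (\bigcap_(C in [set C | clopen C /\ C x]) C).
Proof.
move=> cT hT; set Q := \bigcap_(_ in _) _.
have clQ : closed Q by apply: closed_bigI => C [[]].
have Qx : Q x by move=> C [].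
have half (D E : set T) : closed D -> closed E -> D `&` E = set0 ->
    Q `<=` D `|` E -> D x -> Q `<=` D.
  move=> cD cE DE QDE Dx.
  have [V nV VclE] : filter_from (set_nbhs D) closure (~` E).
    apply: (compact_normal hT cT cD) => y Dy.
    apply: open_nbhs_nbhs; split; first exact: closed_openC.
    by move=> Ey; have : (D `&` E) y by []; rewrite DE.
  have oVV : open (V° `|` ~` closure V).
    by apply: openU; [exact: open_interior|apply: closed_openC; exact: closed_closure].
  have [|C [[oC cC] Cx CV]] := clopen_sub_open (x := x) cT oVV.
    move=> y nVy; apply: contrapT => nC; apply: nVy.
    have /QDE[Dy|Ey] : Q y.
      by move=> C [cC Cx]; apply: contrapT => nCy; apply: nC; exists C.
    - by left; exact: nV.
    - by right=> /VclE.
  have eC : C `&` V° = C `&` closure V.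
    rewrite predeqE => y; split=> -[Cy Vy]; split=> //.
      by apply: subset_closure; exact: interior_subset.
    by case: (CV _ Cy).
  move=> y Qy; have /QDE[//|Ey] := Qy.
  have [_ Vy] : (C `&` V°) y.
    apply: Qy; split; last by split=> //; exact: nV.
    split; first by apply: openI => //; exact: open_interior.
    by rewrite eC; apply: closedI => //; exact: closed_closure.
  by have /VclE := subset_closure (interior_subset Vy).
(* A relatively clopen [B] and its complement in [Q] are both closed; [half] applies to whichever of
   them contains [x]. *)
move=> B [b Bb] [W oO BO] [K cK BK].
have cB : closed B by rewrite BK; exact: closedI.
have cN : closed (Q `&` ~` W) by apply: closedI => //; exact: open_closedC.
have disj : B `&` (Q `&` ~` W) = set0.
  by rewrite BO -subset0 => y [[_ Wy] [_ nWy]].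
have cov : Q `<=` B `|` (Q `&` ~` W).
  by move=> y Qy; rewrite BO; have [Wy|nWy] := pselect (W y); [left|right].
have BQ : B `<=` Q by rewrite BO => y [].
rewrite eqEsubset; split=> //; have /cov[Bx|Nx] := Qx; first exact: half cov Bx.
have : Q `<=` Q `&` ~` W by apply: (half _ B) => //; [rewrite setIC|rewrite setUC].
by move=> /(_ b (BQ b Bb))[_]; move: Bb; rewrite BO => -[].
Qed.

Lemma clopen_nbhs_basis (T : topologicalType) (x : T) (O : set T) :
  compact [set: T] -> hausdorff_space T -> totally_disconnected [set: T] ->
  open O -> O x -> exists C, [/\ clopen C, C x & C `<=` O].
Proof.
move=> cT hT tdT oO Ox; apply: clopen_sub_open => // y nOy.
apply: contrapT => nC.
have : connected_component [set: T] x y.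
  exists (\bigcap_(C in [set C | clopen C /\ C x]) C).
    by split=> //; [move=> C [] | exact: quasi_component_connected].
  by move=> C [cC Cx]; apply: contrapT => nCy; apply: nC; exists C.
by rewrite tdT //= => yx; apply: nOy; rewrite yx.
Qed.

(* Group identities and continuity of translations *)
Declare Scope pg_scope.
Local Open Scope pg_scope.
Local Notation "x * y" := (pg_mul x y) : pg_scope.
Local Notation "x ^-1" := (pg_inv x) : pg_scope.

Section ProfiniteGroup.
Variable G : profinite_group.
Implicit Types (x y z g : G) (H K U V A B X Y N : set G) (R S L : seq G).
Local Notation e := (pg_one G).

Lemma pg_mulKg x y : x^-1 * (x * y) = y.
Proof. by rewrite pg_mulA pg_mulV pg_mul1. Qed.

Lemma pg_mulgV x : x * x^-1 = e.
Proof.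
by rewrite -[LHS](pg_mulKg x^-1) [x^-1 * _]pg_mulA pg_mulV pg_mul1 pg_mulV.
Qed.

Lemma pg_mulVKg x y : x * (x^-1 * y) = y.
Proof. by rewrite pg_mulA pg_mulgV pg_mul1. Qed.

Lemma pg_mulg1 x : x * e = x.
Proof. by rewrite -(pg_mulV x) pg_mulVKg. Qed.

Lemma pg_mul_inj x y z : x * y = x * z -> y = z.
Proof. by move=> /(congr1 (pg_mul x^-1)); rewrite !pg_mulKg. Qed.

Lemma pg_invK x : x^-1^-1 = x.
Proof. by apply: (@pg_mul_inj x^-1); rewrite pg_mulgV pg_mulV. Qed.

Lemma pg_invM x y : (x * y)^-1 = y^-1 * x^-1.
Proof.
apply: (@pg_mul_inj (x * y)).
by rewrite pg_mulgV -pg_mulA pg_mulVKg pg_mulgV.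
Qed.

Lemma pg_inv1 : e^-1 = e.
Proof. by rewrite -[LHS]pg_mul1 pg_mulgV. Qed.

Definition pg_simpl :=
  (pg_invM, pg_invK, pg_inv1, =^~ pg_mulA, pg_mulKg, pg_mulVKg, pg_mulV,
   pg_mulgV, pg_mul1, pg_mulg1).

Lemma subgroup1 H : is_subgroup H -> H e. Proof. by case. Qed.

Lemma subgroupM H x y : is_subgroup H -> H x -> H y -> H (x * y).
Proof. by move=> [_ [HM _]]; exact: HM. Qed.

Lemma subgroupV H x : is_subgroup H -> H x -> H x^-1.
Proof. by move=> [_ [_ HV]]; exact: HV. Qed.

Lemma subgroupI H K : is_subgroup H -> is_subgroup K -> is_subgroup (H `&` K).
Proof.
move=> sH sK; split; first by split; exact: subgroup1.
split=> [x y [Hx Kx] [Hy Ky]|x [Hx Kx]].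
  by split; exact: subgroupM.
by split; exact: subgroupV.
Qed.

Lemma cvg_mul (T : Type) (F : set_system T) (f g : T -> G) x y : Filter F ->
  f @ F --> x -> g @ F --> y -> (fun t => f t * g t) @ F --> x * y.
Proof.
move=> FF fx gy.
have fg : (fun t => (f t, g t)) @ F --> (x, y) by exact: cvg_pair.
exact: (cvg_comp _ _ fg (@pg_mul_cont G (x, y))).
Qed.

Lemma cont_mull g : continuous (fun x => g * x).
Proof. by move=> x; apply: cvg_mul; [exact: cvg_cst|exact: cvg_id]. Qed.

Lemma cont_mulr g : continuous (fun x => x * g).
Proof. by move=> x; apply: cvg_mul; [exact: cvg_id|exact: cvg_cst]. Qed.

Lemma open_translate g X : open X -> open [set x | X (g * x)].
Proof. by apply: open_comp => x _; exact: cont_mull. Qed.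

Lemma closed_translate g X : closed X -> closed [set x | X (g * x)].
Proof. by apply: preimage_closed => x _; exact: cont_mull. Qed.

Lemma closed_translater g X : closed X -> closed [set x | X (x * g)].
Proof. by apply: preimage_closed => x _; exact: cont_mulr. Qed.

Lemma subgroup_open H : is_subgroup H -> nbhs e H -> open H.
Proof.
move=> sH; rewrite nbhsE => -[W [oW We] WH].
rewrite openE => x Hx; rewrite /interior nbhsE.
exists [set y | W (x^-1 * y)].
  by split; [exact: open_translate|rewrite /= pg_mulV].
move=> y /WH Hy; have := subgroupM sH Hx Hy.
by rewrite !pg_simpl.
Qed.

(** * Open normal subgroups as a neighbourhood basis of the identity *)

Definition normal_sub N := forall g x, N x -> N (g * x * g^-1).

(** Take a clopen [C] around the identity inside [O]. Its right stabilizer [K] is open because [C]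
    is compact, and lies in [C] because [C] contains the identity. The normal core [N] of [K] is
    again open because the group, which supplies the conjugating elements, is compact. *)
Lemma open_normal_basis O : open O -> O e ->
  exists N, [/\ open_subgroup N, normal_sub N & N `<=` O].
Proof.
move=> oO Oe.
have [C [[oC cC] Ce CO]] := clopen_nbhs_basis (@pg_compact G) (@pg_hausdorff G)
  (@pg_tdisc G) oO Oe.
pose K := [set x | forall c, (C c -> C (c * x)) /\ (C c -> C (c * x^-1))].
have nbhsC : \forall x \near e, C `<=` [set c | C (c * x)].
  have /compact_near_coveringP : compact C.
    by apply: (subclosed_compact cC (@pg_compact G)).
  apply=> c Cc.
  have : (fun p : G * G => p.1 * p.2) @ (c, e) --> c * e.
    exact: (@pg_mul_cont G (c, e)).
  by apply; apply: open_nbhs_nbhs; rewrite pg_mulg1.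
have sK : is_subgroup K.
  split; first by move=> c; rewrite !pg_simpl.
  split=> [x y Kx Ky c|x Kx c]; last by rewrite pg_invK; case: (Kx c).
  rewrite pg_invM !pg_mulA; split=> Cc.
    by apply: (Ky _).1; apply: (Kx _).1.
  by apply: (Kx _).2; apply: (Ky _).2.
have oK : open K.
  apply: subgroup_open => //.
  have nbhsV : \forall x \near e, C `<=` [set c | C (c * x^-1)].
    have ie : (@pg_inv G) @ e --> e by rewrite -{2}pg_inv1; exact: pg_inv_cont.
    exact: (ie _ nbhsC).
  near=> x => c; split.
    move: c; near: x; exact: nbhsC.
  by move: c; near: x; exact: nbhsV.
pose N := [set x | forall g, K (g * x * g^-1)].
have KN : N `<=` K by move=> x /(_ e); rewrite !pg_simpl.
have sN : is_subgroup N.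
  split; first by move=> g; rewrite !pg_simpl; exact: subgroup1.
  split=> [x y Nx Ny g|x Nx g].
    by have := subgroupM sK (Nx g) (Ny g); rewrite !pg_simpl.
  by have := subgroupV sK (Nx g); rewrite !pg_simpl.
exists N; split.
- split=> //; apply: subgroup_open => //.
  have nN : \forall x \near e, [set: G] `<=` [set g | K (g * x * g^-1)].
    have /compact_near_coveringP := @pg_compact G; apply=> g _.
    have cg : (fun p : G * G => p.1 * p.2 * p.1^-1) @ (g, e) --> g * e * g^-1.
      apply: cvg_mul; first by apply: cvg_mul; [exact: cvg_fst|exact: cvg_snd].
      have p1 : (fun p : G * G => p.1) @ (g, e) --> g by exact: cvg_fst.
      exact: (cvg_comp _ _ p1 (@pg_inv_cont G g)).
    apply: cg; apply: open_nbhs_nbhs; split=> //.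
    by rewrite !pg_simpl; exact: subgroup1.
  by apply: filterS nN => x NTx g; exact: NTx.
- by move=> g x Nx h; have := Nx (h * g); rewrite !pg_simpl.
- by move=> x /KN /(_ e)[/(_ Ce)]; rewrite pg_mul1 => /CO.
Unshelve. all: by end_near. Qed.

Lemma open_subgroup_closed U : open_subgroup U -> closed U.
Proof.
move=> [sU oU]; rewrite -openC openE => x nUx; rewrite /interior nbhsE.
exists [set y | U (x^-1 * y)].
  by split; [exact: open_translate|rewrite /= pg_mulV; exact: subgroup1].
move=> y /= Uxy Uy; apply: nUx.
by have := subgroupM sU Uy (subgroupV sU Uxy); rewrite !pg_simpl.
Qed.

(** * Counting cosets by lists of representatives *)

Definition covers H X R := forall x, X x -> exists2 r, r \in R & H (r^-1 * x).

Definition separated H R :=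
  uniq R /\ {in R &, forall r r', H (r^-1 * r') -> r = r'}.

(** For subgroups [H] and [X], the size of [R] is the size of the [X]-orbit of the coset [H] in G/H;
    for [X] the whole group it is the index of [H]. *)
Definition transversal H X R :=
  [/\ forall r, r \in R -> X r, separated H R & covers H X R].

Lemma separated_size H X R L : is_subgroup H -> (forall r, r \in R -> X r) ->
  separated H R -> covers H X L -> (size R <= size L)%N.
Proof.
move=> sH RX [uR sepR] cL.
pose f r := xget e [set l | l \in L /\ H (l^-1 * r)].
have fP r : r \in R -> f r \in L /\ H ((f r)^-1 * r).
  move=> /RX/cL[l lL Hl].
  by apply: (@xgetPex _ e [set l | l \in L /\ H (l^-1 * r)]); exists l.
rewrite -(size_map f); apply: uniq_leq_size.
  rewrite map_inj_in_uniq // => r r' rR r'R ff'; apply: sepR => //.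
  have [_ Hr] := fP _ rR; have [_ Hr'] := fP _ r'R; rewrite -ff' in Hr'.
  by have := subgroupM sH (subgroupV sH Hr) Hr'; rewrite !pg_simpl.
by move=> _ /mapP[r rR ->]; case: (fP _ rR).
Qed.

Lemma transversal_size_gt0 H X R : is_subgroup X -> transversal H X R ->
  (0 < size R)%N.
Proof.
by move=> sX [_ _ cR]; have [r rR _] := cR _ (subgroup1 sX); case: (R) rR.
Qed.

Lemma transversal_size_le H K R S : is_subgroup H -> H `<=` K ->
  transversal K [set: G] R -> transversal H [set: G] S -> (size R <= size S)%N.
Proof.
move=> sH HK [_ [uR sepR] _] [_ _ cS].
apply: (separated_size sH (X := [set: G])) => //.
by split=> // r r' rR r'R /HK; exact: sepR.
Qed.

(** Each entry of [L] is replaced by a point [x] of [X] in its coset, or dropped if there is none.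
    The induction continues with the points of [X] outside [x H], which is why [X] is an arbitrary
    set. *)
Lemma covers_transversal H X L : is_subgroup H -> covers H X L ->
  exists R, transversal H X R.
Proof.
move=> sH; elim: L X => [|l L IH] X cL.
  by exists [::]; split=> // x /cL[].
have [[x [Xx Hlx]]|nx] := pselect (exists x, X x /\ H (l^-1 * x)); last first.
  apply: (IH X) => y Xy; have [r] := cL _ Xy.
  rewrite inE => /orP[/eqP ->|rL] Hr; last by exists r.
  by exfalso; apply: nx; exists y.
have [|R [RX [uR sepR] cR]] := IH (X `&` [set y | ~ H (x^-1 * y)]).
  move=> y [Xy nHy]; have [r] := cL _ Xy.
  rewrite inE => /orP[/eqP ->|rL] Hr; last by exists r.
  exfalso; apply: nHy.
  by have := subgroupM sH (subgroupV sH Hlx) Hr; rewrite !pg_simpl.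
have nHxR r : r \in R -> ~ H (x^-1 * r) by move=> /RX[].
exists (x :: R); split.
- by move=> r; rewrite inE => /orP[/eqP ->//|/RX[]].
- split=> [|r r'].
    rewrite /= uR andbT; apply/negP => /nHxR; apply.
    by rewrite pg_mulV; exact: subgroup1.
  rewrite !inE => /orP[/eqP ->|rR] /orP[/eqP ->|r'R] // Hr.
  + by case: (nHxR _ r'R).
  + case: (nHxR _ rR); have := subgroupV sH Hr; by rewrite !pg_simpl.
  + exact: sepR.
- move=> y Xy; have [Hxy|nHxy] := pselect (H (x^-1 * y)).
    by exists x; rewrite ?mem_head.
  by have [|r rR Hr] := cR y; [|exists r; rewrite // inE rR orbT].
Qed.

(** By compactness finitely many of the open cosets of [U] cover the group. Here [F] is the filter
    of ever larger lists, so the near-covering property yields one list that covers everything. *)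
Lemma open_subgroup_transversal U X : open_subgroup U ->
  exists R, transversal U X R.
Proof.
move=> [sU oU].
pose F := filter_from [set: seq G] (fun l => [set L : seq G | {subset l <= L}]).
have FF : Filter F.
  apply: filter_from_filter; first by exists [::].
  move=> l l' _ _; exists (l ++ l') => // L /= sL.
  by split=> x xl; apply: sL; rewrite mem_cat xl ?orbT.
have [l _ lU] : \forall L \near F, [set: G] `<=`
    [set x | exists2 r, r \in L & U (r^-1 * x)].
  have /compact_near_coveringP := @pg_compact G; apply=> x _.
  exists ([set y | U (x^-1 * y)], [set L : seq G | {subset [:: x] <= L}]).
    split=> /=; last by exists [:: x].
    apply: open_nbhs_nbhs; split; first exact: open_translate.
    by rewrite /= pg_mulV; exact: subgroup1.
  by move=> [y L] /= [Uy xL]; exists x => //; apply: xL; rewrite mem_head.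
by apply: (@covers_transversal U X l) => // x _; apply: lU.
Qed.

(** This gives the lower bound [G:U] times the size of the [A]-orbit of [V] for the index of [W].
    The product [r * s] lies in [r U] since [A] is inside [U], so its coset determines [r]; after
    cancelling [r], [V] determines [s]. *)
Lemma separated_mul U V W A R S : is_subgroup U -> is_subgroup W ->
  W `<=` U `&` V -> A `<=` U -> (forall s, s \in S -> A s) ->
  separated U R -> separated V S ->
  separated W [seq r * s | r <- R, s <- S].
Proof.
move=> sU sW WUV AU SA [uR sepR] [uS sepS].
have key r s r' s' : r \in R -> s \in S -> r' \in R -> s' \in S ->
    W ((r * s)^-1 * (r' * s')) -> r = r' /\ s = s'.
  move=> rR sS r'R s'S Wrs; have [Urs Vrs] := WUV _ Wrs.
  have rr' : r = r'.
    apply: sepR => //.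
    have := subgroupM sU (subgroupM sU (AU _ (SA _ sS)) Urs)
      (subgroupV sU (AU _ (SA _ s'S))).
    by rewrite !pg_simpl.
  split=> //; apply: sepS => //.
  by move: Vrs; rewrite rr' !pg_simpl.
split.
  apply: allpairs_uniq => // -[r s] [r' s'] /allpairsP[[a b] /= [aR bS [-> ->]]].
  move=> /allpairsP[[a' b'] /= [a'R b'S [-> ->]]] /= eq.
  have [|-> ->//] := key a b a' b' aR bS a'R b'S.
  by rewrite eq pg_mulV; exact: subgroup1.
move=> _ _ /allpairsP[[a b] /= [aR bS ->]] /allpairsP[[a' b'] /= [a'R b'S ->]].
by move=> /key[//|//|//|//|-> ->].
Qed.

Lemma covers_mul N H X R S : is_subgroup H -> covers H X R -> covers N H S ->
  covers N [set x * h | x in X & h in H] [seq r * s | r <- R, s <- S].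
Proof.
move=> sH cR cS _ [x Xx [h Hh <-]].
have [r rR Hr] := cR x Xx; have [s sS Ns] := cS _ (subgroupM sH Hr Hh).
exists (r * s); first by apply/allpairsP; exists (r, s).
by move: Ns; rewrite !pg_simpl.
Qed.

(** * Representative lists and the index; closed subgroups of finite index *)

Lemma lcoset_eq H g r : is_subgroup H -> H (r^-1 * g) ->
  [set g * h | h in H] = [set r * h | h in H].
Proof.
move=> sH Hr; rewrite predeqE => x; split=> -[h Hh <-].
  exists (r^-1 * g * h); last by rewrite !pg_simpl.
  by have := subgroupM sH Hr Hh; rewrite !pg_simpl.
exists (g^-1 * r * h); last by rewrite !pg_simpl.
by have := subgroupM sH (subgroupV sH Hr) Hh; rewrite !pg_simpl.
Qed.

Lemma covers_finite_index H L : is_subgroup H -> covers H [set: G] L -> finite_index H.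
Proof.
move=> sH cL.
apply: (@sub_finite_set _ _ ((fun g => [set g * h | h in H]) @` [set` L])); last first.
  exact: finite_image.
move=> _ [g _ <-]; have [r rL Hr] := cL g I; exists r => //.
by apply/esym; exact: lcoset_eq.
Qed.

Lemma finite_index_covers H : is_subgroup H -> finite_index H ->
  exists L, covers H [set: G] L.
Proof.
move=> sH /finite_seqP[s es]; exists [seq xget e C | C <- s] => x _.
have : lcosets H [set x * h | h in H] by exists x.
rewrite es /= => xs.
have : [set x * h | h in H] !=set0.
  by exists (x * e); exists e => //; exact: subgroup1.
move=> /(xgetPex e)[h Hh eh]; exists (x * h); first by rewrite eh map_f.
by rewrite !pg_simpl; exact: subgroupV.
Qed.

Lemma transversal_index H R : is_subgroup H -> transversal H [set: G] R ->
  index_is H (size R).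
Proof.
move=> sH [_ [uR sepR] cR]; rewrite /index_is.
have -> : lcosets H = (fun i => [set nth e R i * h | h in H]) @` `I_(size R).
  rewrite eqEsubset; split=> [_ [g _ <-]|_ [i _ <-]]; last by exists (nth e R i).
  have [r rR Hr] := cR g I; exists (index r R); first by rewrite /= index_mem.
  by rewrite nth_index //; apply/esym; exact: lcoset_eq.
apply: inj_card_eq => i j; rewrite !inE /= => iR jR eij.
apply/eqP; rewrite -(nth_uniq e iR jR uR); apply/eqP.
apply: sepR; rewrite ?mem_nth //.
have : [set nth e R i * h | h in H] (nth e R j * e).
  by rewrite eij; exists e => //; exact: subgroup1.
by case=> h Hh; rewrite pg_mulg1 => <-; rewrite !pg_simpl.
Qed.

Lemma closed_coset_union K L : closed K ->
  closed [set x | exists2 r, r \in L & K (r^-1 * x)].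
Proof.
move=> cK; elim: L => [|l L IH].
  by rewrite (_ : [set _ | _] = set0); [exact: closed0|rewrite -subset0 => x []].
rewrite (_ : [set _ | _] = [set x | K (l^-1 * x)] `|`
    [set x | exists2 r, r \in L & K (r^-1 * x)]).
  by apply: closedU => //; exact: closed_translate.
rewrite predeqE => x; split=> [[r]|[Kx|[r rL Kr]]].
- by rewrite inE => /orP[/eqP ->|rL] Kr; [left|right; exists r].
- by exists l; rewrite ?mem_head.
- by exists r; rewrite // inE rL orbT.
Qed.

(** The complement of [H] is a finite union of closed cosets, those of the representatives outside
    [H]. *)
Lemma finite_index_open H : closed_subgroup H -> finite_index H -> open_subgroup H.
Proof.
move=> [sH cH] fH; split=> //.
have [L cL] := finite_index_covers sH fH.
have -> : H = ~` [set x | exists2 r, r \in [seq r <- L | ~~ `[< H r >]] & H (r^-1 * x)].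
  rewrite predeqE => x; split=> [Hx [r]|nx].
    rewrite mem_filter => /andP[/asboolPn nHr _] Hrx; apply: nHr.
    by have := subgroupM sH Hx (subgroupV sH Hrx); rewrite !pg_simpl.
  have [r rL Hrx] := cL x I; have [Hr|nHr] := pselect (H r).
    by have := subgroupM sH Hr Hrx; rewrite !pg_simpl.
  by exfalso; apply: nx; exists r => //; rewrite mem_filter rL andbT; apply/asboolPn.
by apply: closed_openC; exact: closed_coset_union.
Qed.

(** * Open subgroups containing a given closed subgroup *)

Lemma subgroup_mul_normal A N : is_subgroup A -> is_subgroup N -> normal_sub N ->
  is_subgroup [set a * n | a in A & n in N].
Proof.
move=> sA sN nN; split.
  by exists e; [exact: subgroup1|exists e; [exact: subgroup1|rewrite pg_mul1]].
split=> [_ _ [a Aa [n Nn <-]] [b Ab [m Nm <-]]|_ [a Aa [n Nn <-]]].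
  exists (a * b); first exact: subgroupM.
  exists (b^-1 * n * b * m); last by rewrite !pg_simpl.
  by apply: subgroupM => //; have := nN b^-1 n Nn; rewrite pg_invK.
exists a^-1; first exact: subgroupV.
exists (a * n^-1 * a^-1); last by rewrite !pg_simpl.
by apply: nN; exact: subgroupV.
Qed.

Lemma open_subgroup_mul_normal A N : is_subgroup A -> open_subgroup N -> normal_sub N ->
  open_subgroup [set a * n | a in A & n in N].
Proof.
move=> sA [sN oN] nN.
have sAN := subgroup_mul_normal sA sN nN; split=> //; apply: subgroup_open => //.
have : nbhs e N by apply: open_nbhs_nbhs; split=> //; exact: subgroup1.
apply: filterS => n Nn; exists e; first exact: subgroup1.
by exists n; rewrite ?pg_mul1.
Qed.

Lemma sub_mul_normal A N : is_subgroup N -> A `<=` [set a * n | a in A & n in N].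
Proof.
by move=> sN a Aa; exists a => //; exists e; [exact: subgroup1|rewrite pg_mulg1].
Qed.

(** If the open normal subgroup [N] is so small that [x N] misses [A], then [A N] is an open
    subgroup missing [x]. *)
Lemma closed_subgroup_sep A x : closed_subgroup A -> ~ A x ->
  exists U, [/\ open_subgroup U, A `<=` U & ~ U x].
Proof.
move=> [sA cA] nAx.
have [||N [oN nN NA]] := @open_normal_basis [set y | (~` A) (x * y)].
- by apply: open_translate; exact: closed_openC.
- by rewrite /= pg_mulg1.
exists [set a * n | a in A & n in N]; split.
- exact: open_subgroup_mul_normal.
- by apply: sub_mul_normal; case: oN.
- move=> [a Aa [n Nn anx]].
  by apply: (NA n^-1); [apply: subgroupV => //; case: oN|rewrite -anx !pg_simpl].
Qed.

(** An open subgroup [U] containing [A] has finite index, so it differs from [A]. Intersecting it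
    with an open subgroup that contains [A] but misses some point of [U] raises the index
    strictly. *)
Lemma large_index_overgroup A n : closed_subgroup A -> ~ finite_index A ->
  exists U R, [/\ open_subgroup U, A `<=` U, transversal U [set: G] R & (n <= size R)%N].
Proof.
move=> cA iA; elim: n => [|n [U [R [oU AU tR nR]]]].
  have oT : open_subgroup [set: G] by split=> //; exact: openT.
  by have [R tR] := open_subgroup_transversal [set: G] oT; exists [set: G], R.
have [[x [Ux nAx]]|UA] := pselect (exists x, U x /\ ~ A x); last first.
  case: iA; have <- : U = A.
    rewrite eqEsubset; split=> // x Ux; apply: contrapT => nAx.
    by apply: UA; exists x.
  by case: tR => _ _; apply: covers_finite_index; case: oU.
have [V [oV AV nVx]] := closed_subgroup_sep cA nAx.
have sU := oU.1.
have oUV : open_subgroup (U `&` V).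
  by split; [exact: subgroupI oV.1|exact: openI oU.2 oV.2].
have [S tS] := open_subgroup_transversal [set: G] oUV.
exists (U `&` V), S; split=> //; first by move=> a Aa; split; [exact: AU|exact: AV].
apply: leq_ltn_trans nR _.
have [_ [uR sepR] cR] := tR; have [r rR Ur] := cR e I.
have {}Ur : U r^-1 by rewrite -[r^-1]pg_mulg1.
(* Since [x] is in [U] but not in [V], the coset [r U] contains the two distinct cosets of [r] and
   [r * x] modulo the intersection, one more than [R] provides. *)
apply: (@separated_size (U `&` V) [set: G] (r * x :: R)) => //.
- exact: oUV.1.
- have nrx s : s \in R -> ~ (U `&` V) (s^-1 * (r * x)).
    move=> sR [Us Vs]; have sr : s = r.
      apply: sepR => //; have := subgroupM sU Us (subgroupV sU Ux).
      by rewrite !pg_simpl.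
    by move: Vs; rewrite sr !pg_simpl.
  split=> [|s s'].
    rewrite /= uR andbT; apply/negP => /nrx; apply; rewrite pg_mulV.
    exact: subgroup1 oUV.1.
  rewrite !inE => /orP[/eqP ->|sR] /orP[/eqP ->|s'R] // Hs.
  + by case: (nrx _ s'R); have := subgroupV oUV.1 Hs; rewrite !pg_simpl.
  + by case: (nrx _ sR).
  + by apply: sepR => //; case: Hs.
- by case: tS.
Qed.

(** * Topological generation and Schreier's bound *)

Lemma closed_subgroup_gen X : closed_subgroup (gen_closed X).
Proof.
split; last by apply: closed_bigI => H [[]].
split; first by move=> H [[sH _] _]; exact: subgroup1.
split=> [x y Hx Hy H [[sH cH] XH]|x Hx H [[sH cH] XH]].
  by apply: subgroupM => //; [exact: Hx|exact: Hy].
by apply: subgroupV => //; exact: Hx.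
Qed.

Lemma sub_gen_closed X : X `<=` gen_closed X.
Proof. by move=> x Xx H [_]; apply. Qed.

Lemma gen_closed_sub X H : closed_subgroup H -> X `<=` H -> gen_closed X `<=` H.
Proof. by move=> cH XH x; apply. Qed.

Lemma generated_byP H S : closed_subgroup H -> (forall s, s \in S -> H s) ->
  H `<=` gen_closed [set x | x \in S] -> generated_by H S.
Proof.
move=> cH SH HS; split; first by move=> s /SH; rewrite inE.
by rewrite eqEsubset; split=> //; exact: gen_closed_sub.
Qed.

Lemma generated_by_cat A B S S' : generated_by A S -> generated_by B S' ->
  generated_by (gen_closed (A `|` B)) (S ++ S').
Proof.
move=> [SA eA] [SB eB]; apply: generated_byP; first exact: closed_subgroup_gen.
  move=> s; rewrite mem_cat => /orP[/SA|/SB]; rewrite inE => ?.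
    by apply: sub_gen_closed; left.
  by apply: sub_gen_closed; right.
apply: gen_closed_sub; first exact: closed_subgroup_gen.
move=> x [Ax|Bx].
  move: Ax; rewrite -{1}eA; move: x; apply: gen_closed_sub.
    exact: closed_subgroup_gen.
  by move=> x /= xS; apply: sub_gen_closed; rewrite /= mem_cat xS.
move: Bx; rewrite -{1}eB; move: x; apply: gen_closed_sub.
  exact: closed_subgroup_gen.
by move=> x /= xS; apply: sub_gen_closed; rewrite /= mem_cat xS orbT.
Qed.

Lemma closed_stabilizer X : closed X -> closed_subgroup
  [set g | forall x, X x -> X (g * x) /\ X (g^-1 * x)].
Proof.
move=> cX; split.
  split; first by move=> x Xx; rewrite !pg_simpl.
  split=> [g h Xg Xh x Xx|g Xg x Xx]; last by rewrite pg_invK; case: (Xg x Xx).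
  rewrite pg_invM -!pg_mulA; split.
    by apply: (Xg _ _).1; apply: (Xh _ _).1.
  by apply: (Xh _ _).2; apply: (Xg _ _).2.
rewrite (_ : [set _ | _] =
    \bigcap_(x in X) ([set g | X (g * x)] `&` [set g | X (g^-1 * x)])).
  apply: closed_bigI => x Xx; apply: closedI; first exact: closed_translater.
  have := closed_translater (g := x) cX.
  by apply: (@preimage_closed _ _ (@pg_inv G)) => g _; exact: pg_inv_cont.
by [].
Qed.

(** With [t x] the representative of [x U] in [R], the Schreier elements [S'] generate a closed
    subgroup [K] of the intersection. The set [X], which is [R K], is stable under [S], hence under
    [B]; this forces [K] to be the whole intersection. *)
Lemma schreier_generation B U S R : generated_by B S -> open_subgroup U ->
  transversal U B R ->
  exists S', size S' = (size R * size S)%N /\ generated_by (B `&` U) S'.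
Proof.
move=> [SB eB] oU [RB [uR sepR] cR].
have [sB cB] : closed_subgroup B by rewrite -eB; exact: closed_subgroup_gen.
have sU := oU.1.
pose t x := xget e [set r | r \in R /\ U (r^-1 * x)].
have tP x : B x -> t x \in R /\ U ((t x)^-1 * x).
  move=> /cR[r rR Ur].
  by apply: (@xgetPex _ e [set r | r \in R /\ U (r^-1 * x)]); exists r.
pose S' := [seq (t (s * r))^-1 * (s * r) | r <- R, s <- S].
pose K := gen_closed [set x | x \in S'].
have [sK cK] : closed_subgroup K := closed_subgroup_gen _.
have {}SB s : s \in S -> B s by move=> /SB; rewrite inE.
have cBU : closed_subgroup (B `&` U).
  split; first exact: subgroupI.
  by apply: closedI => //; exact: open_subgroup_closed.
have S'BU x : x \in S' -> (B `&` U) x.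
  move=> /allpairsP[[r s] /= [rR sS ->]].
  have Bsr : B (s * r) by apply: subgroupM => //; [exact: SB|exact: RB].
  have [tR Ut] := tP _ Bsr; split=> //.
  by apply: subgroupM => //; apply: subgroupV => //; exact: RB.
have KBU : K `<=` B `&` U by apply: gen_closed_sub => // x; exact: S'BU.
have S'K r s : r \in R -> s \in S -> K ((t (s * r))^-1 * (s * r)).
  by move=> rR sS; apply: sub_gen_closed; apply/allpairsP; exists (r, s).
exists S'; split; first by rewrite size_allpairs.
apply: generated_byP => //; rewrite -/K.
pose X := [set x | exists2 r, r \in R & K (r^-1 * x)].
have cX : closed X by exact: closed_coset_union.
(* [X] is closed, so its stabilizer is a closed subgroup, and it suffices that
   it contains [S]. *)
have BX : B `<=` [set g | forall x, X x -> X (g * x) /\ X (g^-1 * x)].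
  rewrite -{1}eB; apply: gen_closed_sub; first exact: closed_stabilizer.
  move=> s /= sS x [r rR Kr]; split.
    have [tR _] := tP (s * r) (subgroupM sB (SB _ sS) (RB _ rR)).
    exists (t (s * r)) => //.
    by have := subgroupM sK (S'K _ _ rR sS) Kr; rewrite !pg_simpl.
  (* For the inverse of [s], the Schreier element of [s] and [r'] is used backwards: [s * r'] has
     representative [r] again. *)
  have [tR Ut] := tP (s^-1 * r) (subgroupM sB (subgroupV sB (SB _ sS)) (RB _ rR)).
  set r' := t (s^-1 * r) in tR Ut; exists r' => //.
  have [t'R Ut'] := tP (s * r') (subgroupM sB (SB _ sS) (RB _ tR)).
  have tr : t (s * r') = r.
    apply: sepR => //; have := subgroupM sU Ut' Ut.
    by rewrite !pg_simpl.
  have := subgroupM sK (subgroupV sK (S'K _ _ tR sS)) Kr.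
  by rewrite tr !pg_simpl.
(* The representative [r1] of [U] itself may differ from the identity, so the stability of [X] is
   applied to the conjugate of [x] by [r1]. It maps [r1] to [r1 * x], whose representative is [r1],
   so [x] is in [K]. *)
have [t1R Ut1] := tP e (subgroup1 sB); set r1 := t e in t1R Ut1.
have {}Ut1 : U r1 by have := subgroupV sU Ut1; rewrite !pg_simpl.
have Br1 := RB _ t1R.
move=> x [Bx Ux].
have Xr1 : X r1 by exists r1 => //; rewrite pg_mulV; exact: subgroup1.
have Bx' : B (r1 * x * r1^-1).
  by apply: subgroupM => //; [exact: subgroupM|exact: subgroupV].
have [[r rR Kr] _] := BX _ Bx' _ Xr1.
rewrite !pg_simpl in Kr.
have rr1 : r = r1.
  apply: sepR => //; have := subgroupM sU (KBU _ Kr).2 (subgroupV sU Ux).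
  by rewrite !pg_simpl.
by move: Kr; rewrite rr1 !pg_simpl.
Qed.

(** * Index bounds from the rank gradient and coset counts *)

Lemma positive_rank_gradient_index : positive_rank_gradient G ->
  exists E : nat, forall U R S, open_subgroup U -> transversal U [set: G] R ->
    generated_by U S -> (size R <= E * size S)%N.
Proof.
(* [E] exceeds the inverse of [eps], so [eps] times the index being at most d(U) - 1 bounds the
   index by [E] d(U), where d(U) is at most the size of [S]. *)
move=> [eps [eps0 H]]; exists (Num.bound eps^-1%R) => U R S oU tR gS.
set E := Num.bound _.
have Eeps : (1 < E%:R * eps)%R.
  rewrite -ltr_pdivrMr // mul1r; apply: le_lt_trans (archi_boundP _).
    by rewrite lexx.
  by rewrite invr_ge0 ltW.
pose P n := `[< exists S' : seq G, size S' = n /\ generated_by U S' >].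
have exP : exists n, P n by exists (size S); apply/asboolP; exists S.
have rk : rank_is U (ex_minn exP).
  case: ex_minnP => n /asboolP Pn minn; split=> // S' gS'.
  by apply: minn; apply/asboolP; exists S'.
have nS : (ex_minn exP <= size S)%N by apply: rk.2.
have := H _ _ _ oU rk (transversal_index oU.1 tR).
set n := ex_minn exP in nS *; set k := size R.
have k0 : (0 < k)%N by apply: transversal_size_gt0 tR.
rewrite ler_pdivlMr ?ltr0n // => ek.
rewrite -(ler_nat rat) natrM.
apply: le_trans (_ : (E%:R * eps * k%:R <= _)%R).
  by rewrite ler_peMl ?ler0n // ltW.
rewrite -mulrA ler_wpM2l ?ler0n //; apply: le_trans ek _.
apply: le_trans (_ : (n%:R <= _)%R); last by rewrite ler_nat.
by rewrite lerBlDr lerDl ler01.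
Qed.

(* Both sides count cosets of [N]: [B A N] is covered by the translates
   [r T s^-1] with [r] in [Rb] and [s] in [Ra]. *)
Lemma orbit_size_bound A B U V T N Ra Rb Ro Rm Rt :
  is_subgroup A -> is_subgroup B -> is_subgroup T ->
  open_subgroup N -> normal_sub N -> N `<=` T ->
  A `&` V `<=` T -> B `&` U `<=` T ->
  transversal V A Ra -> transversal U B Rb ->
  transversal [set a * n | a in A & n in N] B Ro ->
  transversal [set a * n | a in A & n in N] [set: G] Rm ->
  transversal T [set: G] Rt ->
  (size Ro * size Rt <= size Ra * size Rb * size Rm)%N.
Proof.
move=> sA sB sT oN nN NT AVT BUT [RaA _ cRa] [RbB _ cRb].
set H := [set a * n | a in A & n in N] => -[RoB sepRo _] [_ _ cRm] [_ sepRt _].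
have sN := oN.1; have sH : is_subgroup H by exact: subgroup_mul_normal.
have NH : N `<=` H.
  by move=> n Nn; exists e; [exact: subgroup1|exists n; rewrite ?pg_mul1].
have [Sh [ShH sepSh cSh]] := open_subgroup_transversal H oN.
have [St [StT sepSt cSt]] := open_subgroup_transversal T oN.
have Sh0 : (0 < size Sh)%N.
  by have [r rR _] := cSh e (subgroup1 sH); case: (Sh) rR.
(* That is, [G:T][T:N] is at most [G:H][H:N]. Combined with [leRo], this eliminates [T:N], and the
   positive factor [H:N] cancels. *)
have leRt : (size Rt * size St <= size Rm * size Sh)%N.
  rewrite -!(size_allpairs (@pg_mul G)).
  apply: (separated_size (H := N) (X := [set: G])) => //.
    by apply: (separated_mul (U := T) (V := N) (W := N) (A := T)) => // n Nn;
      split=> //; exact: NT.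
  move=> x _; apply: (covers_mul sH cRm cSh).
  by exists x => //; exists e; [exact: subgroup1|rewrite pg_mulg1].
have leRo : (size Ro * size Sh <= size Rb * size St * size Ra)%N.
  rewrite -(size_allpairs (@pg_mul G) Ro) -(size_allpairs (@pg_mul G) Rb).
  rewrite -(size_allpairs (fun p a : G => p * a^-1)).
  apply: (separated_size (H := N) (X := [set b * h | b in B & h in H])) => //.
  - move=> _ /allpairsP[[r s] /= [rR sS ->]].
    by exists r; [exact: RoB|exists s => //; exact: ShH].
  - by apply: (separated_mul (U := H) (V := N) (W := N) (A := H)) => // n Nn;
      split=> //; exact: NH.
  (* Here [b] is in [r T] and the inverse of [a] is in [s T], so [b * a] is in [r T s^-1]; normality
     moves the factors from [N] past [s]. *)
  move=> _ [b Bb [_ [a Aa [n Nn <-]] <-]].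
  have [r rR Ur] := cRb b Bb.
  have [s sR Vs] := cRa a^-1 (subgroupV sA Aa).
  have Tb : T (r^-1 * b).
    by apply: BUT; split=> //; apply: subgroupM => //; apply: subgroupV => //; exact: RbB.
  have Ta : T (s^-1 * a^-1).
    by apply: AVT; split=> //; apply: subgroupM => //; apply: subgroupV => //; exact: RaA.
  have [t tS Nt] := cSt _ (subgroupM sT Tb (subgroupV sT Ta)).
  exists (r * t * s^-1).
    apply/allpairsP; exists (r * t, s) => /=; split=> //.
    by apply/allpairsP; exists (r, t).
  by have := subgroupM sN (nN s _ Nt) Nn; rewrite !pg_simpl.
rewrite -(leq_pmul2r Sh0).
have := leq_mul leRo (leqnn (size Rt)).
have := leq_mul (leqnn (size Ra * size Rb)) leRt.
nia.
Qed.

(** If [W] had finite index, that index would be at most [E] times the sum of the two Schreier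
    bounds. The factor 2 in the hypotheses makes each of the two terms less than half of the
    index. *)
Lemma gen_open_parts_infinite_index (E : nat) A B U V SA SB Ra Rb Ru Rv :
  (forall W R S, open_subgroup W -> transversal W [set: G] R ->
    generated_by W S -> (size R <= E * size S)%N) ->
  is_subgroup A -> is_subgroup B ->
  generated_by A SA -> generated_by B SB ->
  open_subgroup U -> open_subgroup V -> A `<=` U -> B `<=` V ->
  transversal V A Ra -> transversal U B Rb ->
  transversal U [set: G] Ru -> transversal V [set: G] Rv ->
  (2 * E * size SA < size Ru)%N -> (2 * E * size SB < size Rv)%N ->
  ~ finite_index (gen_closed ((A `&` V) `|` (B `&` U))).
Proof.
move=> HE sA sB gA gB oU oV AU BV tRa tRb tRu tRv leu lev.
set W := gen_closed _ => fW.
have cW : closed_subgroup W := closed_subgroup_gen _.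
have oW := finite_index_open cW fW.
have [Rw tRw] := open_subgroup_transversal [set: G] oW.
have [SA' [sSA gA']] := schreier_generation gA oV tRa.
have [SB' [sSB gB']] := schreier_generation gB oU tRb.
have := HE _ _ _ oW tRw (generated_by_cat gA' gB').
rewrite size_cat sSA sSB.
have WUV : W `<=` U `&` V.
  apply: gen_closed_sub.
    split; first exact: subgroupI oU.1 oV.1.
    by apply: closedI; exact: open_subgroup_closed.
  by move=> x [[/AU]|[/BV]].
have [RaA sRa cRa] := tRa; have [RbB sRb cRb] := tRb.
have [_ _ cRw] := tRw; have [_ sRu _] := tRu; have [_ sRv _] := tRv.
have leU : (size Ru * size Ra <= size Rw)%N.
  rewrite -(size_allpairs (@pg_mul G)).
  apply: (separated_size (H := W) (X := [set: G])) => //; first exact: cW.1.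
  by apply: (separated_mul (U := U) (V := V) (W := W) (A := A)) => //; [exact: oU.1|exact: cW.1].
have leV : (size Rv * size Rb <= size Rw)%N.
  rewrite -(size_allpairs (@pg_mul G)).
  apply: (separated_size (H := W) (X := [set: G])) => //; first exact: cW.1.
  apply: (separated_mul (U := V) (V := U) (W := W) (A := B)) => //; [exact: oV.1|exact: cW.1|].
  by rewrite setIC.
have Ra0 := transversal_size_gt0 sA tRa.
have Rb0 := transversal_size_gt0 sB tRb.
have := leq_mul leu (leqnn (size Ra)); have := leq_mul lev (leqnn (size Rb)).
nia.
Qed.

End ProfiniteGroup.

(** * Construction of the open subgroup of [B] *)

Theorem theorem5p1 (G : profinite_group) (A B : set G) :
  fin_generated [set: G] ->
  positive_rank_gradient G ->
  closed_subgroup A -> fin_generated A -> ~ finite_index A ->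
  closed_subgroup B -> fin_generated B -> ~ finite_index B ->
  exists B0 : set G, open_subgroup_of B B0 /\
    ~ finite_index (gen_closed (A `|` B0)).
Proof.
move=> _ /positive_rank_gradient_index[E HE] cA [SA gA] iA cB [SB gB] iB.
have [sA _] := cA; have [sB _] := cB.
have [U [Ru [oU AU tRu leu]]] := large_index_overgroup (2 * E * size SA).+1 cA iA.
have [V [Rv [oV BV tRv lev]]] := large_index_overgroup (2 * E * size SB).+1 cB iB.
have [Ra tRa] := open_subgroup_transversal A oV.
have [Rb tRb] := open_subgroup_transversal B oU.
have iW := gen_open_parts_infinite_index HE sA sB gA gB oU oV AU BV
  tRa tRb tRu tRv leu lev.
set W := gen_closed _ in iW.
(* The index of [T] is chosen so that [orbit_size_bound] makes 2 [E] d times the [B]-orbit of [H] at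
   most [G:H], with d the size of [SB]. *)
have [T [Rt [oT WT tRt letT]]] := large_index_overgroup
  (2 * E * size SB * (size Ra * size Rb)).+1 (closed_subgroup_gen _) iW.
(* Inside [T] for the orbit bound; inside [U] so that [H] lies in [U] and [G:H] exceeds 2 [E] times
   the size of [SA]. *)
have [||N [oN nN NTU]] := @open_normal_basis G (T `&` U).
- exact: openI oT.2 oU.2.
- by split; exact: subgroup1 (_ : open_subgroup _).1.
pose H := [set pg_mul a n | a in A & n in N].
have oH : open_subgroup H by exact: open_subgroup_mul_normal.
have HU : H `<=` U.
  by move=> _ [a /AU Ua [n /NTU[_ Un] <-]]; exact: subgroupM oU.1 Ua Un.
have [Ro tRo] := open_subgroup_transversal B oH.
have [Rm tRm] := open_subgroup_transversal [set: G] oH.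
have bound : (size Ro * size Rt <= size Ra * size Rb * size Rm)%N.
  apply: (orbit_size_bound (U := U) (V := V) sA sB oT.1 oN nN) => //.
  - by move=> n /NTU[].
  - by move=> x Ax; apply: WT; apply: sub_gen_closed; left.
  - by move=> x Bx; apply: WT; apply: sub_gen_closed; right.
exists (B `&` H); split.
  split; first exact: subgroupI oH.1.
  by split; [move=> x []|exists H; split=> //; exact: oH.2].
set K := gen_closed _ => fK.
have cK : closed_subgroup K := closed_subgroup_gen _.
have oK := finite_index_open cK fK.
have KH : K `<=` H.
  apply: gen_closed_sub; first by split; [exact: oH.1|exact: open_subgroup_closed].
  by move=> x [Ax|[]//]; apply: sub_mul_normal => //; exact: oN.1.
have [Rk tRk] := open_subgroup_transversal [set: G] oK.
have [S' [sS' gS']] := schreier_generation gB oH tRo.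
have := HE _ _ _ oK tRk (generated_by_cat gA gS').
rewrite size_cat sS'.
have leH := transversal_size_le oK.1 KH tRm tRk.
have leU := transversal_size_le oH.1 HU tRu tRm.
have Ra0 := transversal_size_gt0 sA tRa; have Rb0 := transversal_size_gt0 sB tRb.
(* The generators from [B] thus account for at most half of [G:H] and those from [A] for less than
   half, while the index of [K] is at least [G:H]. *)
have : (2 * E * size SB * size Ro <= size Rm)%N.
  have ab0 : (0 < size Ra * size Rb)%N by rewrite muln_gt0 Ra0.
  rewrite -(leq_pmul2l ab0); apply: leq_trans bound.
  have := leq_mul (leqnn (size Ro)) (ltnW letT); nia.
nia.
Qed.
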